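(* Let $y\in F(\mathcal D(F))$ and let, for two functionals $\mathcal R:X\to[0,\infty]$, $\mathcal S:Y\times Y\to[0,\infty]$, conditions (i)--(v) of the context and the generalized triangle inequality (T) of the context hold, as well as $\partial\mathcal R(x^\dagger)\neq\emptyset$, where $x^\dagger\in\mathcal D(F)$, the solution in condition (v), satisfies the following variational source condition: for some $\xi^\dagger\in\partial\mathcal R(x^\dagger)$ and some index function $\phi$ there exists $\beta\in[0,1)$ such that for all $\tilde x\in\{x\in\mathcal D(F):\mathcal R(x)\le\mathcal R(x^\dagger)\}$ $$-\langle\xi^\dagger,\tilde x-x^\dagger\rangle\le\beta D_{\xi^\dagger}(\tilde x,x^\dagger)+\phi\bigl(\mathcal S(F(\tilde x),F(x^\dagger))\bigr).$$ Moreover, let $(y^\delta)_{\delta>0}$ be a family of noisy data such that $\mathcal S(y,y^\delta)\le\delta$ holds. Then the convergence rate $$D_{\xi^\dagger}(\hat x^\delta,x^\dagger)\le\frac{1}{1-\beta}\,\phi\bigl(C_S(\tau+1)\,\delta\bigr)$$ holds for $\hat x^\delta=x^\delta_{Mo}$ and for $\hat x^\delta=x^\delta_\rho$ with $\rho$ according to rule I or rule II. If additionally condition (vi) of the context holds, then the same holds true for $\hat x^\delta=x^\delta_\rho$ with $\rho$ according to rule III.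
   Context: Setting: $(X,\mathcal T_X)$, $(Y,\mathcal T_Y)$ are topological spaces, $X$ carrying in addition a linear structure and a duality pairing $\langle\cdot,\cdot\rangle$ between its dual $X^*$ and $X$, and $F:\mathcal D(F)\subseteq X\to Y$. The subdifferential is $\partial\mathcal R(x)=\{\xi\in X^*:\mathcal R(\tilde x)\ge\mathcal R(x)+\langle\xi,\tilde x-x\rangle\ \forall\tilde x\in X\}$ and, for $\xi\in\partial\mathcal R(x)$, $D_\xi(\tilde x,x)=\mathcal R(\tilde x)-\mathcal R(x)-\langle\xi,\tilde x-x\rangle$ is the Bregman distance. An index function is a monotonically increasing $\phi:\mathbb R^+\to\mathbb R^+$ with $\lim_{t\to0}\phi(t)=0$. For $\rho\ge0$ put $X^{ad}(\rho)=\{x\in\mathcal D(F):\mathcal R(x)\le\rho\}$. Morozov problem: minimize $\mathcal R(x)$ over $x\in\mathcal D(F)$ subject to $\mathcal S(F(x),y^\delta)\le\tau\delta$; a minimizer is denoted $x^\delta_{Mo}$. Ivanov problem with radius $\rho\ge0$: minimize $\mathcal S(F(x),y^\delta)$ over $x\in X^{ad}(\rho)$; a minimizer is denoted $x^\delta_\rho$. Choices of the radius. Rule I: $\rho_*^I=\mathcal R(x^\dagger)$. Rule II: $\rho_*^{II}$ is the minimum of the set of all $\rho\ge0$ such that a minimizer $x^\delta_\rho$ of the Ivanov problem exists and $\mathcal S(F(x^\delta_\rho),y^\delta)\le\tau\delta$. Rule III: $\rho_*^{III}$ is a $\rho$ such that a minimizer $x^\delta_\rho$ of the Ivanov problem exists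 and $\delta<\mathcal S(F(x^\delta_\rho),y^\delta)\le\tau\delta$. In all of these $\tau\ge1$ is a fixed constant independent of $\delta$. Conditions: (i) $F$ is $\mathcal T_X$-$\mathcal T_Y$-sequentially closed: if $(x_n)_{n\in\mathbb N}\subseteq\mathcal D(F)$, $x_n\to x$ in $\mathcal T_X$ and $F(x_n)\to z$ in $\mathcal T_Y$, then $x\in\mathcal D(F)$ and $F(x)=z$. (ii) $\mathcal R$ and $\mathcal S(\cdot,y^\delta)$ are lower semicontinuous with respect to $\mathcal T_X$ and $\mathcal T_Y$, respectively. (iii) For any $C>0$ the sublevel set $\{x\in\mathcal D(F):\mathcal R(x)\le C\}$ is $\mathcal T_X$-compact. (iv) For any $C>0$ and any $y^\delta\in Y$ the sublevel set $\{z\in F(\mathcal D(F)):\mathcal S(z,y^\delta)\le C\}$ is $\mathcal T_Y$-compact. (v) There exists a solution $x^\dagger$ of $F(x)=y$ with $\mathcal R(x^\dagger)<\infty$. (vi) There exists $\rho_0\ge0$ such that a minimizer $x^\delta_{\rho_0}$ of the Ivanov problem with radius $\rho_0$ exists and $\delta<\mathcal S(F(x^\delta_{\rho_0}),y^\delta)$. If $\rho_0<\rho_*^{II}$, then additionally: (a) for all $\rho\in(\rho_0,\rho_*^{II}]$ and all zero sequences $(d_n)_{n\in\mathbb N}$ (i.e. real sequences with $d_n\to0$) there exists a sequence of mappings $\varphi_n:X^{ad}(\rho)\to X^{ad}(\rho+d_n)$, $n\in\mathbb N$, such that $\mathcal S(F(\varphi_n(x)),y^\delta)\to\mathcal S(F(x),y^\delta)$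 as $n\to\infty$ for all $x\in X^{ad}(\rho)$; (b) for all $\rho\in(\rho_0,\rho_*^{II}]$ at most one minimizer $x^\delta_\rho$ of the Ivanov problem exists. (T) There exists a constant $C_S>0$ such that for all $y_1,y_2,y_3\in Y$: $\mathcal S(y_1,y_3)\le C_S\bigl(\mathcal S(y_1,y_2)+\mathcal S(y_3,y_2)\bigr)$.
   Formalization: ''Compact'' in conditions (iii) and (iv) is read as sequentially compact; with cover compactness in general topological spaces the rate for rule II can fail, since an Ivanov minimizer of radius R(x†) need not exist. *)

(* Defs.v *)
(* MathComp-Analysis, over an arbitrary R : realType. *)
From HB Require Import structures.
From mathcomp Require Import all_boot all_order all_algebra.
From mathcomp Require Import all_classical all_reals all_analysis.
Set Implicit Arguments.
Unset Strict Implicit.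
Unset Printing Implicit Defensive.
Import Order.TTheory GRing.Theory Num.Theory.
Import numFieldNormedType.Exports.
Local Open Scope classical_set_scope.
Local Open Scope ring_scope.

Section Topology.

(* Sequential compactness is used where the source says "compact": for
   arbitrary topologies and a map that is only sequentially closed, cover
   compactness does not provide the convergent subsequences on which existence
   of minimizers rests. *)
Definition seq_compact (T : topologicalType) (A : set T) : Prop :=
  forall u : nat -> T, (forall n, A (u n)) ->
  exists2 x : T, A x & exists2 s : nat -> nat,
    {homo s : m n / (m < n)%N} & (u \o s) @ \oo --> x.

(* F is total in Rocq, but only its restriction to D is ever used. *)
Definition seq_closed (X Y : topologicalType) (D : set X) (F : X -> Y) : Prop :=
  forall (u : nat -> X) (x : X) (z : Y),
    (forall n, D (u n)) -> u @ \oo --> x -> (F \o u) @ \oo --> z ->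
    D x /\ F x = z.

End Topology.

Section IndexFunction.
Context {R : realType}.

(* A function on [0, +oo[; its values at negative arguments are irrelevant. *)
Definition index_function (phi : R -> R) : Prop :=
  [/\ (forall t, 0 <= t -> 0 <= phi t),
      (forall s t, 0 <= s -> s <= t -> phi s <= phi t) &
      phi t @[t --> 0^'+] --> (0 : R)].

(* Convention phi(+oo) = +oo. The value at -oo is irrelevant, as the misfit
   functional is nonnegative. *)
Definition index_ext (phi : R -> R) (t : \bar R) : \bar R :=
  if t is r%:E then (phi r)%:E else +oo%E.

End IndexFunction.

Section Bregman.
(* The dual of X enters through its pairing with X only: X need not carry a
   norm, nor the topology with respect to which the dual is taken. *)
Context {R : realType} {X Xs : lmodType R}.
Variables (pair : {bilinear Xs -> X -> R^o}) (Reg : X -> \bar R).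

Definition subdifferential (x : X) : set Xs :=
  [set xi | forall x', (Reg x + (pair xi (x' - x))%:E <= Reg x')%E].

Definition bregman (xi : Xs) (x' x : X) : \bar R :=
  (Reg x' - Reg x - (pair xi (x' - x))%:E)%E.

End Bregman.

Definition is_minimizer {R : realType} {T : Type} (f : T -> \bar R)
    (A : set T) (x : T) : Prop :=
  A x /\ forall x', A x' -> (f x <= f x')%E.

Section Problems.
Context {R : realType} {X : preTopologicalLmodType R} {Y : topologicalType}.
Variables (D : set X) (F : X -> Y) (Reg : X -> \bar R) (S : Y -> Y -> \bar R).

Definition Xad (rho : R) : set X := [set x | D x /\ (Reg x <= rho%:E)%E].

Definition generalized_triangle (CS : R) : Prop :=
  forall y1 y2 y3 : Y, (S y1 y3 <= CS%:E * (S y1 y2 + S y3 y2))%E.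

Definition variational_source_condition {Xs : lmodType R}
    (pair : {bilinear Xs -> X -> R^o}) (xd : X) (xi : Xs) (phi : R -> R)
    (beta : R) : Prop :=
  forall x, D x -> (Reg x <= Reg xd)%E ->
    ((- pair xi (x - xd))%:E <=
       beta%:E * bregman pair Reg xi x xd + index_ext phi (S (F x) (F xd)))%E.

Variables (tau delta : R) (ydelta : Y).

Definition morozov_minimizer (x : X) : Prop :=
  is_minimizer Reg [set x' | D x' /\ (S (F x') ydelta <= (tau * delta)%:E)%E] x.

Definition ivanov_minimizer (rho : R) (x : X) : Prop :=
  is_minimizer (fun x' => S (F x') ydelta) (Xad rho) x.

Definition rule_I (xd : X) (rho : R) : Prop := rho%:E = Reg xd.

Definition rule_II_set : set R :=
  [set rho | 0 <= rho /\ exists2 x, ivanov_minimizer rho x &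
    (S (F x) ydelta <= (tau * delta)%:E)%E].

Definition rule_II (rho : R) : Prop := rule_II_set rho /\ lbound rule_II_set rho.

Definition rule_III (rho : R) : Prop :=
  0 <= rho /\ exists2 x, ivanov_minimizer rho x &
    (delta%:E < S (F x) ydelta <= (tau * delta)%:E)%E.

(* The sets Xad are only considered for nonnegative radii, whence the
   restriction on the zero sequences d. A map Xad rho -> Xad (rho + d n) is
   given by a total function on X that sends the former set to the latter. *)
Definition recovery_maps (rho : R) : Prop :=
  forall d : nat -> R, d @ \oo --> (0 : R) -> (forall n, 0 <= rho + d n) ->
  exists2 psi : nat -> X -> X,
    (forall n, set_fun (Xad rho) (Xad (rho + d n)) (psi n)) &
    forall x, Xad rho x ->
      S (F (psi n x)) ydelta @[n --> \oo] --> S (F x) ydelta.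

Definition rule_III_condition : Prop :=
  exists rho0 : R,
    [/\ 0 <= rho0,
        (exists2 x, ivanov_minimizer rho0 x & (delta%:E < S (F x) ydelta)%E) &
        forall rho2 : R, rule_II rho2 -> rho0 < rho2 ->
          forall rho, rho0 < rho <= rho2 ->
            recovery_maps rho /\ is_subset1 (ivanov_minimizer rho)].

End Problems.

(* Main.v *)
Require Import Defs.
From HB Require Import structures.
From mathcomp Require Import all_boot all_order all_algebra.
From mathcomp Require Import all_classical all_reals all_analysis.
From mathcomp Require Import lra.
Set Implicit Arguments.
Unset Strict Implicit.
Unset Printing Implicit Defensive.
Import Order.TTheory GRing.Theory Num.Theory.
Import numFieldNormedType.Exports.
Local Open Scope classical_set_scope.
Local Open Scope ring_scope.

(** The rate follows from two facts about the regularized solution [x]: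
    [Reg x <= Reg xd] and [S (F x) yd <= tau * delta]. The first puts [x] in the
    range of the source condition; with the second and the noise bound, the
    triangle inequality gives [S (F x) y <= CS * (tau + 1) * delta]. As
    [Reg x <= Reg xd], the Bregman distance is at most [- pair xi (x - xd)], so
    in the source condition the term with [beta] can be absorbed on the left
    ([bregman_rate]).

    These two facts hold for every method because [xd] itself is an admissible
    competitor: its misfit is at most [delta], hence at most [tau * delta].

    - Morozov: [xd] satisfies the constraint, so [Reg x <= Reg xd].
    - Rule I: [xd] has the admissible radius, so the misfit of [x] is at most
      that of [xd].
    - Rule II: the misfit bound comes with the rule, and the radius is at most
      [Reg xd] because [Reg xd] belongs to the set that the rule minimizes
      over. Membership requires an Ivanov minimizer of radius [Reg xd] to
      exist; the direct method of the calculus of variations provides it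
      ([ivanov_minimizer_exists]).
    - Rule III: the misfit of [x] is larger than [delta], hence larger than that
      of [xd]; so [xd] cannot be admissible, and the radius is below
      [Reg xd]. *)

(** * Existence of Ivanov minimizers *)

Lemma lsc_limit_le (R : realType) (I : Type) (T : topologicalType)
    (f : T -> \bar R) (u : I -> T) (G : set_system I) (x : T) (c : R) :
  ProperFilter G -> lower_semicontinuous f -> u @ G --> x ->
  (\forall i \near G, (f (u i) <= c%:E)%E) -> (f x <= c%:E)%E.
Proof.
move=> PG lscf ux uc; rewrite leNgt; apply/negP => /lscf[V nV cV].
have [i [fuc Vu]] := filter_ex (filterI uc (ux _ nV)).
by move: (cV _ Vu); rewrite ltNge fuc.
Qed.

Lemma homo_ltn_id_le (s : nat -> nat) :
  {homo s : m n / (m < n)%N} -> forall n, (n <= s n)%N.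
Proof.
move=> sS; elim=> // n IHn.
by apply: (leq_ltn_trans IHn); exact: sS.
Qed.

Lemma homo_ltn_cvg_infty (s : nat -> nat) :
  {homo s : m n / (m < n)%N} -> s n @[n --> \oo] --> \oo.
Proof.
move=> /homo_ltn_id_le s_ge A [N _ NA]; exists N => // n /= Nn.
by apply: NA => /=; exact: leq_trans Nn (s_ge n).
Qed.

(** The direct method: along a minimizing sequence, compactness of the sublevel
    sets of [Reg] and of the misfit provides a subsequence along which both
    [u n] and [F (u n)] converge. Since [F] is sequentially closed the limits
    match, and semicontinuity shows that the limit is admissible and optimal. *)
Lemma ivanov_minimizer_exists (R : realType) (X : preTopologicalLmodType R)
    (Y : topologicalType) (D : set X) (F : X -> Y) (Reg : X -> \bar R)
    (S : Y -> Y -> \bar R) (w : Y) (rho : R) (x0 : X) :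
  (forall z, (0 <= S z w)%E) ->
  seq_closed D F ->
  lower_semicontinuous Reg ->
  lower_semicontinuous (fun z => S z w) ->
  (forall C : R, 0 < C -> seq_compact [set x | D x /\ (Reg x <= C%:E)%E]) ->
  (forall C : R, 0 < C -> seq_compact [set z | (F @` D) z /\ (S z w <= C%:E)%E]) ->
  Xad D Reg rho x0 -> (S (F x0) w < +oo)%E ->
  exists x, ivanov_minimizer D F Reg S w rho x.
Proof.
move=> S_ge0 F_closed Reg_lsc S_lsc Reg_cpt S_cpt x0ad Sx0.
set V := [set S (F x) w | x in Xad D Reg rho].
have inf_ge0 : (0 <= ereal_inf V)%E by apply/ereal_infP => _ [x _ <-].
have inf_fin : ereal_inf V \is a fin_num.
  rewrite ge0_fin_numE//.
  by apply: le_lt_trans Sx0; apply: ereal_inf_lbound; exists x0.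
set m := fine (ereal_inf V).
have m_ge0 : 0 <= m by exact: fine_ge0.
have infE : ereal_inf V = m%:E by rewrite fineK.
have /choice[u uP] (n : nat) : exists x,
    Xad D Reg rho x /\ (S (F x) w <= (m + n.+1%:R^-1)%:E)%E.
  have [//|_ [x xad <-] /ltW] := @lb_ereal_inf_adherent _ V n.+1%:R^-1 _ inf_fin.
  by rewrite infE -EFinD => ?; exists x.
(* The radius may be 0, while compactness is for positive levels; the maximum
   with 1 covers this case, and semicontinuity of Reg recovers the level rho. *)
have [||x1 _ [s sS us]] := Reg_cpt (Num.max rho 1) _ u.
- by rewrite lt_max ltr01 orbT.
- move=> n; have [[Du Ru] _] := uP n; split=> //.
  by apply: le_trans Ru _; rewrite lee_fin le_max lexx.
have [||z _ [t tS Fust]] := S_cpt (m + 1) _ (F \o (u \o s)).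
- exact: ltr_wpDl.
- move=> n; have [[Du Ru] Su] := uP (s n); split; first by exists (u (s n)).
  apply: le_trans Su _; rewrite lee_fin lerD2l.
  by rewrite invf_le1 ?ltr0n// ler1n.
have ust : (u \o s \o t) @ \oo --> x1.
  exact: cvg_comp (homo_ltn_cvg_infty tS) us.
have [Dx1 Fx1] : D x1 /\ F x1 = z.
  by apply: (F_closed _ _ _ _ ust Fust) => n; have [[]] := uP (s (t n)).
exists x1; split=> [|x xad].
  split=> //; apply: lsc_limit_le Reg_lsc ust _.
  by near=> n; have [[]] := uP (s (t n)).
have : (m%:E <= S (F x) w)%E by rewrite -infE; apply: ereal_inf_lbound; exists x.
apply: le_trans; apply/lee_addgt0Pr => e e0; rewrite Fx1 -EFinD.
apply: (lsc_limit_le _ S_lsc Fust).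
near=> n.
have [_ Su] := uP (s (t n)); apply: le_trans Su _.
rewrite lee_fin lerD2l.
have st_ge : (n <= s (t n))%N.
  exact: leq_trans (homo_ltn_id_le tS n) (homo_ltn_id_le sS (t n)).
apply: (@le_trans _ _ n.+1%:R^-1).
  by rewrite lef_pV2 ?posrE ?ltr0n// ler_nat.
apply/ltW; near: n.
exact: (near_infty_natSinv_lt (PosNum e0)).
Unshelve. all: by end_near. Qed.

(** * The rate under the source condition *)

Lemma index_ext_le (R : realType) (phi : R -> R) (t : \bar R) (T : R) :
  index_function phi -> (0 <= t)%E -> (t <= T%:E)%E ->
  (index_ext phi t <= (phi T)%:E)%E.
Proof.
move=> [_ phi_mono _]; case: t => [t| |] //=; rewrite !lee_fin.
exact: phi_mono.
Qed.

(** With [B] the Bregman distance and [p := pair xi (x - xd)], the inequality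
    [Reg x <= Reg xd] reads [B <= - p]. The source condition then gives
    [B <= beta * B + phi T], to be solved for [B]; this is legitimate since [B]
    is finite. *)
Lemma bregman_rate (R : realType) (X : preTopologicalLmodType R)
    (Y : topologicalType) (Xs : lmodType R) (pair : {bilinear Xs -> X -> R^o})
    (D : set X) (F : X -> Y) (Reg : X -> \bar R) (S : Y -> Y -> \bar R)
    (beta T : R) (x xd : X) (xi : Xs) (phi : R -> R) :
  (forall x, (0 <= Reg x)%E) -> index_function phi -> beta < 1 ->
  variational_source_condition D F Reg S pair xd xi phi beta ->
  (Reg xd < +oo)%E -> D x -> (Reg x <= Reg xd)%E ->
  (0 <= S (F x) (F xd))%E -> (S (F x) (F xd) <= T%:E)%E ->
  (bregman pair Reg xi x xd <= ((1 - beta)^-1 * phi T)%:E)%E.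
Proof.
move=> Reg_ge0 phiP beta1 vsc Rxd Dx Rx S_ge0 ST.
have := vsc x Dx Rx; rewrite /bregman.
have := index_ext_le phiP S_ge0 ST; move: (index_ext _ _) => I IT.
have Rx_fin : Reg x \is a fin_num by rewrite ge0_fin_numE // (le_lt_trans Rx).
move: Rx; rewrite -(fineK Rx_fin).
have /fineK <- : Reg xd \is a fin_num by rewrite ge0_fin_numE.
move: (fine (Reg x)) (fine (Reg xd)) (pair _ _) => r rd p.
rewrite lee_fin => r_le src.
have : ((- p)%:E <= (beta * (r - rd - p) + phi T)%:E)%E.
  by apply: le_trans src _; rewrite EFinD; exact: leeD2l.
rewrite -!EFinB !lee_fin => src'.
by rewrite ler_pdivlMl ?subr_gt0//; lra.
Qed.

Lemma misfit_le (R : realType) (Y : topologicalType) (S : Y -> Y -> \bar R)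
    (CS a b : R) (z y w : Y) :
  generalized_triangle S CS -> 0 < CS ->
  (S z w <= a%:E)%E -> (S y w <= b%:E)%E -> (S z y <= (CS * (a + b))%:E)%E.
Proof.
move=> tri CS0 Sz Sy; apply: le_trans (tri z w y) _.
by rewrite EFinM EFinD lee_pmul2l ?lte_fin//; exact: leeD.
Qed.

(** * The convergence rates *)

Theorem corollary2p9 (R : realType) (X : preTopologicalLmodType R)
  (Y : topologicalType) (Xs : lmodType R) (pair : {bilinear Xs -> X -> R^o})
  (D : set X) (F : X -> Y) (Reg : X -> \bar R) (S : Y -> Y -> \bar R)
  (y : Y) (yd : R -> Y) (tau CS beta : R) (xd : X) (xi : Xs) (phi : R -> R)
  (Reg_ge0 : forall x, (0 <= Reg x)%E)
  (S_ge0 : forall z w, (0 <= S z w)%E)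
  (tau_ge1 : 1 <= tau)
  (y_range : (F @` D) y)
  (F_closed : seq_closed D F)
  (Reg_lsc : lower_semicontinuous Reg)
  (S_lsc : forall delta, 0 < delta ->
    lower_semicontinuous (fun z => S z (yd delta)))
  (Reg_compact : forall C : R, 0 < C ->
    seq_compact [set x | D x /\ (Reg x <= C%:E)%E])
  (S_compact : forall (C : R) (w : Y), 0 < C ->
    seq_compact [set z | (F @` D) z /\ (S z w <= C%:E)%E])
  (xd_sol : [/\ D xd, F xd = y & (Reg xd < +oo)%E])
  (CS_gt0 : 0 < CS)
  (S_triangle : generalized_triangle S CS)
  (subdiff_nonempty : subdifferential pair Reg xd !=set0)
  (xi_subdiff : subdifferential pair Reg xd xi)
  (phi_index : index_function phi)
  (beta_01 : 0 <= beta < 1)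
  (vsc : variational_source_condition D F Reg S pair xd xi phi beta)
  (noise : forall delta, 0 < delta -> (S y (yd delta) <= delta%:E)%E) :
  let rate (delta : R) (x : X) : Prop :=
    (bregman pair Reg xi x xd <=
       ((1 - beta)^-1 * phi (CS * (tau + 1) * delta))%:E)%E in
  forall delta, 0 < delta ->
    [/\ forall x, morozov_minimizer D F Reg S tau delta (yd delta) x ->
          rate delta x,
        forall rho x, rule_I Reg xd rho ->
          ivanov_minimizer D F Reg S (yd delta) rho x -> rate delta x,
        forall rho x, rule_II D F Reg S tau delta (yd delta) rho ->
          ivanov_minimizer D F Reg S (yd delta) rho x -> rate delta x &
        rule_III_condition D F Reg S tau delta (yd delta) ->
        forall rho x, rule_III D F Reg S tau delta (yd delta) rho ->
          ivanov_minimizer D F Reg S (yd delta) rho x -> rate delta x].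
Proof.
move=> rate delta delta0.
have [Dxd Fxd Rxd] := xd_sol.
have beta1 : beta < 1 by case/andP: beta_01.
have noise_xd : (S (F xd) (yd delta) <= delta%:E)%E by rewrite Fxd; exact: noise.
have delta_le : (delta%:E <= (tau * delta)%:E)%E.
  by rewrite lee_fin ler_peMl // ltW.
have rateP x : D x -> (Reg x <= Reg xd)%E ->
    (S (F x) (yd delta) <= (tau * delta)%:E)%E -> rate delta x.
  move=> Dx Rx Sx.
  apply: (bregman_rate Reg_ge0 phi_index beta1 vsc Rxd Dx Rx (S_ge0 _ _)).
  by rewrite -mulrA mulrDl mul1r; exact: misfit_le S_triangle CS_gt0 Sx noise_xd.
split.
- move=> x [[Dx Sx] xmin]; apply: rateP => //.
  by apply: xmin; split=> //; exact: le_trans delta_le.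
- move=> rho x rhoE [[Dx Rx] xmin].
  apply: rateP; rewrite -?rhoE//.
  apply: le_trans delta_le; apply: le_trans noise_xd.
  by apply: xmin; split=> //; rewrite rhoE.
- move=> rho x [[_ [x1 [x1ad _] Sx1]] rho_lb] [[Dx Rx] xmin].
  have rdE : Reg xd = (fine (Reg xd))%:E by rewrite fineK // ge0_fin_numE.
  have xd_ad : Xad D Reg (fine (Reg xd)) xd by split; rewrite // -rdE.
  have [x2 x2min] : exists x2,
      ivanov_minimizer D F Reg S (yd delta) (fine (Reg xd)) x2.
    apply: (ivanov_minimizer_exists _ F_closed Reg_lsc (S_lsc _ delta0)
      Reg_compact _ xd_ad) => [z|C|]; [exact: S_ge0|exact: S_compact|].
    exact: le_lt_trans noise_xd (ltry _).
  have rho_le : rho <= fine (Reg xd).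
    apply: rho_lb; split; first exact: fine_ge0.
    exists x2 => //; apply: le_trans delta_le; apply: le_trans noise_xd.
    exact: x2min.2.
  apply: rateP => //; last exact: le_trans (xmin _ x1ad) Sx1.
  by apply: le_trans Rx _; rewrite rdE lee_fin.
- move=> _ rho x [_ [x1 [x1ad x1min] /andP[Sx1_gt Sx1_le]]] [[Dx Rx] xmin].
  apply: rateP => //; last exact: le_trans (xmin _ x1ad) Sx1_le.
  apply: le_trans Rx _; rewrite leNgt; apply/negP => Rxd_lt.
  move: Sx1_gt; rewrite ltNge (le_trans _ noise_xd) //.
  by apply: x1min; split=> //; exact: ltW.
Qed.
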